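(* For any formula $\phi_0$ of $\mathcal L$: (1) if $w\nVdash\phi_0$ for some world $w$ of a Kripke model, then $\{\xi_u\}_{u\in U}\nvDash\phi_0$ for any enumeration $\{\xi_u\}_{u\in U}$ of nondeterministic partial recursive functions; (2) if $w\nVdash\phi_0$ for some world $w$ of a deterministic Kripke model, then $\{\xi_u\}_{u\in U}\nvDash\phi_0$ for any enumeration $\{\xi_u\}_{u\in U}$ of deterministic partial recursive functions.
   Context: The language $\mathcal L$: formulas built from propositional variables and $\bot$ using $\rightarrow$ and a binary modality $\rhd$. Kripke model: a triple $\langle W,\rightarrow,\Vdash\rangle$ with $W$ a finite set of worlds, $\rightarrow$ a ternary relation written $u\rightarrow_w v$, and $\Vdash$ a relation between worlds and propositional variables, extended by: $w\nVdash\bot$; $w\Vdash\phi\rightarrow\psi$ iff $w\nVdash\phi$ or $w\Vdash\psi$; $w\Vdash\phi\rhd\psi$ iff for all $u,v$ with $u\rightarrow_w v$ and $u\Vdash\phi$ there is $v'$ with $u\rightarrow_w v'$ and $v'\Vdash\psi$. It is deterministic if for all $w,u$ there is at most one $v$ with $u\rightarrow_w v$. Semantics: $U$ is a universe (e.g. all words over an alphabet) and $\{\xi_u\}_{u\in U}$ is an enumeration, indexed by elements of $U$, of all nondeterministic (resp. all deterministic) partial recursive functions from $U$ to $U$; $\xi_w(x)\subseteq U$ is the set of all values a machine for $\xi_w$ may return on input $x$ (at most one element in the deterministic case). The enumeration is assumed to satisfy the following form of Kleene's recursion theorem: for any total recursive functions $f_1,\dots,f_n:U^n\to U$ there are $u_1,\dots,u_n\in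 U$ with $\xi_{u_i}\equiv\xi_{f_i(u_1,\dots,u_n)}$ for all $1\le i\le n$. A valuation $*$ maps propositional variables to subsets of $U$, extended by $\bot^*=\varnothing$, $(\phi\rightarrow\psi)^*=(U\setminus\phi^* )\cup\psi^*$, $(\phi\rhd\psi)^*=\{w\in U\mid\forall u\in\phi^*\ (\xi_w(u)\neq\varnothing\rightarrow\xi_w(u)\cap\psi^*\neq\varnothing)\}$. $\{\xi_u\}_{u\in U}\vDash\phi$ means $\phi^*=U$ for every valuation $*$. *)

(* Defs.v *)
From mathcomp Require Import all_boot.
From mathcomp Require Import boolp classical_sets.

Set Implicit Arguments.
Unset Strict Implicit.
Unset Printing Implicit Defensive.

Local Open Scope classical_set_scope.

Inductive formula : Type :=
| Var of nat
| Bot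
| Imp of formula & formula
| Rhd of formula & formula.

(* [trans w u v] is u ->_w v: the world that labels the arrow comes first. *)
Record kripke_model : Type := KripkeModel {
  world :> finType;
  trans : world -> world -> world -> Prop;
  atom : world -> nat -> Prop
}.

Fixpoint forces (K : kripke_model) (w : K) (phi : formula) : Prop :=
  match phi with
  | Var p => atom w p
  | Bot => False
  | Imp a b => ~ forces w a \/ forces w b
  | Rhd a b => forall u v : K, trans w u v -> forces u a ->
                 exists v' : K, trans w u v' /\ forces v' b
  end.

Definition deterministic (K : kripke_model) : Prop :=
  forall w u v v' : K, trans w u v -> trans w u v' -> v = v'.

(* Mu-recursive programs of arity n on the natural numbers.  The flag [nd]
   tells whether the nondeterministic instruction [Choice], which runs either
   of two programs, is available; with [nd = false] these are the usual
   deterministic programs for partial recursive functions. *)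
Inductive prog (nd : bool) : nat -> Type :=
| Zero n : prog nd n
| Succ : prog nd 1
| Proj n of 'I_n : prog nd n
| Comp m n of prog nd m & ('I_m -> prog nd n) : prog nd n
| PrimRec n of prog nd n & prog nd n.+2 : prog nd n.+1
| Mu n of prog nd n.+1 : prog nd n
| Choice n of nd & prog nd n & prog nd n : prog nd n.

(* [eval p xs y]: some run of [p] on input [xs] halts with output [y].  In
   [PrimRec] the recursion argument is the first one; [g] receives the
   counter, the previous value and the parameters, in this order. *)
Fixpoint eval nd n (p : prog nd n) : n.-tuple nat -> set nat :=
  match p in prog _ n return n.-tuple nat -> set nat with
  | Zero _ => fun _ => [set 0]
  | Succ => fun xs => [set (thead xs).+1]
  | Proj _ i => fun xs => [set tnth xs i]
  | Comp m _ f g => fun xs => [set y | exists ys : m.-tuple nat,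
      (forall i, eval (g i) xs (tnth ys i)) /\ eval f ys y]
  | PrimRec n f g => fun xs =>
      let ps : n.-tuple nat := [tuple of behead xs] in
      (fix rec (k : nat) : set nat :=
         if k is k'.+1
         then [set y | exists r, rec k' r /\ eval g [tuple of k' :: r :: ps] y]
         else eval f ps) (thead xs)
  | Mu _ f => fun xs => [set y | eval f [tuple of y :: xs] 0 /\
      forall k, k < y -> exists r, eval f [tuple of k :: xs] r.+1]
  | Choice _ _ f g => fun xs => eval f xs `|` eval g xs
  end.

Lemma eval_functional n (p : prog false n) (xs : n.-tuple nat) (y z : nat) :
  eval p xs y -> eval p xs z -> y = z.
Proof.
elim: p xs y z => {n} /=.
- by move=> n xs y z -> ->.
- by move=> xs y z -> ->.
- by move=> n i xs y z -> ->.
- move=> m n f IHf g IHg xs y z [ys [gy fy]] [zs [gz fz]].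
  have eyz : ys = zs by apply: eq_from_tnth => i; apply: IHg (gy i) (gz i).
  by rewrite eyz in fy; apply: IHf fy fz.
- move=> n f IHf g IHg xs; move: (thead xs) => k.
  elim: k => [|k IHk] y z; first exact: IHf.
  by move=> [r [hr gy]] [s [hs gz]]; rewrite (IHk _ _ hr hs) in gy; apply: IHg gy gz.
- move=> n f IHf xs y z [y0 ylt] [z0 zlt].
  case: (ltngtP y z) => // [/zlt|/ylt] [r hr].
    by have := IHf _ _ _ y0 hr.
  by have := IHf _ _ _ z0 hr.
- by [].
Qed.

(* A universe is a type U with a bijective numbering [code : U -> nat], through
   which computability is transported from nat to U (for words over a finite
   alphabet: their position in the length-lexicographic order).  A possibly
   partial and multivalued n-ary function on U is given by its sets of
   values. *)
Definition recursive (nd : bool) (U : Type) (code : U -> nat) n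
    (F : n.-tuple U -> set U) : Prop :=
  exists p : prog nd n, forall (xs : n.-tuple U) (y : U),
    F xs y <-> eval p [tuple of map code xs] (code y).

Definition partial_recursive (nd : bool) (U : Type) (code : U -> nat)
    (g : U -> set U) : Prop :=
  recursive nd code (fun xs : 1.-tuple U => g (thead xs)).

Definition total_recursive (U : Type) (code : U -> nat) n
    (f : n.-tuple U -> U) : Prop :=
  recursive false code (fun xs => [set f xs]).

Definition recursion_theorem (U : Type) (code : U -> nat)
    (xi : U -> U -> set U) : Prop :=
  forall n (f : 'I_n -> n.-tuple U -> U),
    (forall i, total_recursive code (f i)) ->
    exists u : n.-tuple U, forall i, xi (tnth u i) =1 xi (f i u).

Definition enumeration (nd : bool) (U : Type) (code : U -> nat)
    (xi : U -> U -> set U) : Prop :=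
  [/\ forall u, partial_recursive nd code (xi u),
      forall g, partial_recursive nd code g -> exists u, xi u =1 g
    & recursion_theorem code xi].

Fixpoint interp (U : Type) (xi : U -> U -> set U) (val : nat -> set U)
    (phi : formula) : set U :=
  match phi with
  | Var p => val p
  | Bot => set0
  | Imp a b => ~` interp xi val a `|` interp xi val b
  | Rhd a b => [set w | forall u, interp xi val a u ->
                 xi w u !=set0 -> xi w u `&` interp xi val b !=set0]
  end.

Definition valid (U : Type) (xi : U -> U -> set U) (phi : formula) : Prop :=
  forall val : nat -> set U, interp xi val phi = setT.

(* Main.v *)
Require Import Defs.
From mathcomp Require Import all_boot.
From mathcomp Require Import boolp classical_sets.

(** A formula of depth [k] only sees the first [k] steps of a Kripke model, so
    the model may be unravelled into layers: a copy of [w] in layer [j.+1] only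
    has arrows between points of layer [j], and layer [0] has none that matter.
    Each copy is then described by a finite relation between earlier points,
    hence by a partial recursive function, and no self-reference is needed.
    The recursion theorem serves only to keep the copies of distinct worlds
    distinct: it shows that every partial recursive function has infinitely
    many indices.  In this way no s-m-n theorem is required of the
    enumeration. *)

Set Implicit Arguments.
Unset Strict Implicit.
Unset Printing Implicit Defensive.

Local Open Scope classical_set_scope.

(** * Programs for finite relations on numbers *)

Section Programs.
Variable nd : bool.

Lemma const_prog n c :
  exists p : prog nd n, forall xs y, eval p xs y <-> y = c.
Proof.
elim: c => [|c [p hp]]; first by exists (Zero nd n).
exists (Comp (Succ nd) (fun=> p)) => xs y /=; split.
  by case=> ys [hys ->]; rewrite -(proj1 (hp _ _) (hys ord0)).
move=> ->; exists [tuple c]; split => // i.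
by rewrite ord1; apply/hp.
Qed.

(** Primitive recursion on the input splits off the value at 0; its step drops the previous value
    and runs the program for the shifted function on the counter. *)
Lemma eventually_const_prog N c (F : nat -> nat) :
  (forall x, N <= x -> F x = c) ->
  exists p : prog nd 1, forall xs y, eval p xs y <-> y = F (thead xs).
Proof.
elim: N F => [|N IH] F hF.
  have [p hp] := const_prog 1 c; exists p => xs y.
  by rewrite hp hF.
have [p hp] := IH (F \o succn) (fun x Nx => hF x.+1 Nx).
have [p0 hp0] := const_prog 0 (F 0).
exists (PrimRec p0 (Comp p (fun=> Proj nd (@ord0 1)))) => xs y /=.
elim: (thead xs) y => [|k IHk] y; first exact: hp0.
split=> [[r [_ [ys [hys /hp ->]]]]|->].
  by rewrite /= /thead hys.
exists (F k); split; first exact/IHk.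
exists [tuple k]; split; last exact/hp.
by move=> i; rewrite ord1.
Qed.

Lemma seq_nat_bound (s : seq nat) :
  exists N, forall x, N <= x -> x \notin s.
Proof.
exists (\max_(i <- s) i).+1 => x; apply: contraTN => xs.
by rewrite -leqNgt; apply: leq_bigmax_seq xs _.
Qed.

Lemma finite_support_prog (s : seq nat) c (F : nat -> nat) :
  (forall x, x \notin s -> F x = c) ->
  exists p : prog nd 1, forall xs y, eval p xs y <-> y = F (thead xs).
Proof.
move=> hF; have [N hN] := seq_nat_bound s.
by apply: (@eventually_const_prog N c) => x /hN /hF.
Qed.

(* An unbounded search that halts at once on [s] and diverges off [s] cuts the
   domain of a total program down to [s]. *)
Lemma finite_fun_prog (s : seq nat) (F : nat -> nat) :
  exists p : prog nd 1, forall xs y,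
    eval p xs y <-> thead xs \in s /\ y = F (thead xs).
Proof.
have [t ht] := @finite_support_prog s 0 (fun x => if x \in s then F x else 0)
  (fun x xs => ifN _ _ xs).
have [d hd] := @finite_support_prog s 1 (fun x => if x \in s then 0 else 1)
  (fun x xs => ifN _ _ xs).
(* The last argument is the input; projecting to it makes the test independent of the search
   counter. *)
pose D := Mu (Comp d (fun=> Proj nd (@ord_max 1))).
have hD (xs : 1.-tuple nat) y : eval D xs y <-> thead xs \in s /\ y = 0.
  have hq k z : eval (Comp d (fun=> Proj nd (@ord_max 1))) [tuple of k :: xs] z
      <-> z = if thead xs \in s then 0 else 1.
    have th : tnth [tuple of k :: xs] ord_max = thead xs.
      by rewrite /thead !(tnth_nth 0).
    split=> [[ys [/= hys /hd ->]]|->].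
      by have := hys ord0; rewrite th /thead => ->.
    exists [tuple thead xs]; split; last exact/hd.
    by move=> i; rewrite ord1 /= th.
  rewrite /D; split.
    case=> /hq; case: ifP => // xs_s _ ylt; split => //.
    by case: y ylt => // y /(_ 0 isT) [r /hq]; rewrite xs_s.
  by case=> xs_s ->; split; [apply/hq; rewrite xs_s|].
(* The value comes from [t], but the composition also requires [D] to halt. *)
exists (Comp (Proj nd (@ord0 1)) (fun i => if i == ord0 then t else D)) => xs y.
split=> [[ys [/= hys ->]]|[xs_s ->]].
  have /hD [xs_s _] := hys ord_max; split=> //.
  by have /ht := hys ord0; rewrite xs_s.
exists [tuple F (thead xs); 0]; split => //= i.
by case: i => [[|[|//]] //=] i_lt; [apply/ht; rewrite xs_s | apply/hD].
Qed.

(** With [Choice], a finite relation is a union of one-pair functions; a single-valued one is a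
    total function cut down to a finite domain. *)
Lemma finite_relation_prog (G : seq (nat * nat)) :
  nd \/ (forall x y z, (x, y) \in G -> (x, z) \in G -> y = z) ->
  exists p : prog nd 1, forall xs y, eval p xs y <-> (thead xs, y) \in G.
Proof.
case=> [ndT|fG].
  elim: G => [|[a b] G [q hq]].
    by have [p hp] := finite_fun_prog [::] id; exists p => xs y; rewrite hp; split=> [[]|].
  have [p hp] := finite_fun_prog [:: a] (fun=> b).
  exists (Defs.Choice ndT p q) => xs y /=; rewrite in_cons xpair_eqE.
  split=> [[/hp[]|/hq ->]|].
  - by rewrite inE => -> ->; rewrite eqxx.
  - by rewrite orbT.
  by case/orP=> [/andP[xa /eqP ->]|h]; [left; apply/hp; rewrite inE|right; apply/hq].
pose F x := head 0 [seq q.2 | q <- G & q.1 == x].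
have GF x : x \in unzip1 G -> (x, F x) \in G.
  case/mapP=> -[a b] abG /= ->; rewrite /F.
  case E : [seq q <- G | q.1 == a] => [|[c d] s] /=.
    by have := in_nil (a, b); rewrite -E mem_filter abG eqxx.
  have : (c, d) \in [seq q <- G | q.1 == a] by rewrite E mem_head.
  by rewrite mem_filter => /andP[/eqP /= ->].
have [p hp] := finite_fun_prog (unzip1 G) F.
exists p => xs y; rewrite hp; split=> [[xG ->]|xyG]; first exact: GF.
have xG : thead xs \in unzip1 G by apply/mapP; exists (thead xs, y).
by split=> //; apply: fG xyG (GF _ xG).
Qed.

End Programs.

(** * Indices of finite relations, and fresh indices *)

Section Enumeration.
Variables (nd : bool) (U : Type) (code : U -> nat) (xi : U -> U -> set U).
Hypotheses (code_bij : bijective code) (xi_enum : enumeration nd code xi).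

Let code_inj : injective code := bij_inj code_bij.

Lemma finite_relation_index (G : seq (nat * nat)) :
  nd \/ (forall x y z, (x, y) \in G -> (x, z) \in G -> y = z) ->
  exists u, forall x y, xi u x y <-> (code x, code y) \in G.
Proof.
move=> /finite_relation_prog [p hp]; case: xi_enum => _ surj _.
have [|u hu] := surj (fun x => [set y | (code x, code y) \in G]).
  exists p => xs y; rewrite hp /=.
  by rewrite /thead tnth_map.
by exists u => x y; rewrite hu.
Qed.

(** The empty function and the one whose only pair has codes [(0, 0)] both have indices and differ,
    so [g] misses one of them. *)
Lemma other_index (g : U -> set U) : exists a, ~ xi a =1 g.
Proof.
have [|a ha] := @finite_relation_index [::]; first by right.
have [|b hb] := @finite_relation_index [:: (0, 0)].
  by right=> x y z; rewrite !inE => /eqP[_ ->] /eqP[_ ->].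
have [ag|] := pselect (xi a =1 g); last by exists a.
exists b => bg; case: code_bij => decode _ decodeK.
suff /ha : xi a (decode 0) (decode 0) by [].
by rewrite ag -bg; apply/hb; rewrite decodeK inE.
Qed.

(* A fixed point of the map that swaps the known indices of [xi e] for a wrong
   index, and everything else for [e], is a further index of [xi e]. *)
Lemma fresh_index e (s : seq nat) :
  exists u, xi u =1 xi e /\ code u \notin s.
Proof.
have [a ha] := other_index (xi e).
pose s' := [seq c <- s | `[< exists2 u, code u = c & xi u =1 xi e >]].
pose f (xs : 1.-tuple U) := if code (thead xs) \in s' then a else e.
case: xi_enum => _ _ kleene.
have [|u /(_ ord0) hu] := kleene 1 (fun=> f).
  move=> _; have [|p hp] := @finite_support_prog false s' (code e)
    (fun x => if x \in s' then code a else code e).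
    by move=> x /negPf ->.
  exists p => xs y; rewrite hp /= {1}/thead tnth_map -/(thead xs) /f.
  by split=> [->|]; case: ifP => // _ /code_inj.
(* A fixed point with code in [s'] would index both [xi a] and [xi e]; otherwise it indexes [xi e],
   so its code cannot lie in [s] without lying in [s']. *)
move: hu; rewrite /f -/(thead u); case: ifP => [us hu|us hu].
  move: us; rewrite mem_filter => /andP[/asboolP[v /code_inj -> hv] _].
  by case: ha => x; rewrite -hu hv.
exists (thead u); split=> //; apply/negP => us'.
by move/negP: us; apply; rewrite mem_filter us' andbT; apply/asboolP; exists (thead u).
Qed.

Lemma fresh_indices (K : finType) (e : K -> U) (s : seq nat) :
  exists d : K -> U,
    [/\ injective d, forall w, xi (d w) =1 xi (e w) & forall w, code (d w) \notin s].
Proof.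
suff [d [d1 d2 d3]] : exists d : K -> U,
    [/\ {in enum K &, injective d}, {in enum K, forall w, xi (d w) =1 xi (e w)}
      & {in enum K, forall w, code (d w) \notin s}].
  by exists d; split=> [w v|w|w]; [apply: d1|apply: d2|apply: d3]; rewrite mem_enum.
elim: (enum K) => [|w l [d [d1 d2 d3]]]; first by exists e.
have [u [hu]] := fresh_index (e w) (s ++ [seq code (d v) | v <- l]).
rewrite mem_cat negb_or => /andP[us ul].
have dN v : v \in l -> u <> d v.
  by move=> vl uv; move: ul; rewrite uv => /negP; apply; apply/mapP; exists v.
exists (fun v => if v == w then u else d v); split.
- move=> x y; rewrite !inE.
  case: eqP => [->|_] /=; case: eqP => [->|_] //= xl yl.
  + by move/(dN _ yl).
  + by move=> /esym /(dN _ xl).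
  exact: d1.
- by move=> v; rewrite inE; case: eqP => [->|_] //= /d2.
- by move=> v; rewrite inE; case: eqP => [->|_] //= /d3.
Qed.

(** * Layered copies of a Kripke model *)

Variable K : kripke_model.
Hypothesis K_det : nd \/ deterministic K.

(** Injectivity of [e] makes the copied arrow relation single-valued when the model is
    deterministic. *)
Lemma layer_index (e : K -> U) (w : K) : injective e ->
  exists a, forall x y,
    xi a x y <-> exists u v, [/\ x = e u, y = e v & trans w u v].
Proof.
move=> e_inj.
pose G := [seq (code (e q.1), code (e q.2)) | q <- enum {: K * K} & `[< trans w q.1 q.2 >]].
have GP c d : (c, d) \in G <->
    exists u v, [/\ c = code (e u), d = code (e v) & trans w u v].
  split=> [/mapP[[u v]]|[u [v [-> -> uv]]]].
    by rewrite mem_filter => /andP[/asboolP uv _] [-> ->]; exists u, v.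
  by apply/mapP; exists (u, v) => //; rewrite mem_filter mem_enum andbT; apply/asboolP.
have [|a ha] := @finite_relation_index G.
  case: K_det => [|det]; [by left|right=> x y z].
  move=> /GP[u [v [-> -> uv]]] /GP[u' [v' [/code_inj/e_inj eu -> uv']]].
  by rewrite -eu in uv'; rewrite (det _ _ _ _ uv uv').
exists a => x y; rewrite ha GP; split=> -[u [v [hx hy uv]]]; exists u, v.
  by split=> //; apply: code_inj.
by rewrite hx hy.
Qed.

(** A point determines its world across all layers, so a valuation can be read off from worlds
    alone. *)
Lemma layers k : exists e : nat -> K -> U,
  (forall i j w v, i <= k -> j <= k -> e i w = e j v -> w = v) /\
  (forall j w x y, j < k -> xi (e j.+1 w) x y <->
     exists u v, [/\ x = e j u, y = e j v & trans w u v]).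
Proof.
elim: k => [|k [e [e_inj he]]].
  have [a _] := other_index (fun=> set0).
  have [d [d_inj _ _]] := @fresh_indices K (fun=> a) [::].
  exists (fun=> d); split=> // i j w v _ _; exact: d_inj.
have /choice [a ha] := fun w => @layer_index (e k) w (fun u v => e_inj k k u v (leqnn _) (leqnn _)).
(* Avoiding the codes of layers 0 to [k] rules out any clash between the new layer and an old
   one. *)
have [d [d_inj hd dN]] :=
  @fresh_indices K a [seq code (e i w) | i <- iota 0 k.+1, w <- enum K].
have d_new i w v : i <= k -> d w <> e i v.
  move=> ik dwe; move/negP: (dN w); apply; rewrite dwe.
  by apply: allpairs_f; rewrite ?mem_enum // mem_iota.
exists (fun j => if j == k.+1 then d else e j); split.
  move=> i j w v; rewrite (leq_eqVlt i) (leq_eqVlt j).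
  case: eqP => [_|_] /=; case: eqP => [_|_] //= ik jk.
  - exact: d_inj.
  - by move/d_new => /(_ jk).
  - by move/esym/d_new => /(_ ik).
  exact: e_inj.
move=> j w x y jk; rewrite (ltn_eqF jk) eqSS.
case: eqP => [->|/eqP jNk]; first by rewrite hd ha.
by apply: he; rewrite ltn_neqAle jNk.
Qed.

Fixpoint depth (phi : formula) : nat :=
  match phi with
  | Var _ | Bot => 0
  | Imp a b => maxn (depth a) (depth b)
  | Rhd a b => (maxn (depth a) (depth b)).+1
  end.

(** Truth at a copy of [v] in layer [j] matches forcing at [v] for formulas of depth at most [j],
    since each [Rhd] uses up one layer; the top layer then refutes [phi]. *)
Lemma refuted_not_valid (w : K) phi : ~ forces w phi -> ~ valid xi phi.
Proof.
have [e [e_inj he]] := layers (depth phi).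
pose val p : set U := [set x | exists j v, [/\ j <= depth phi, x = e j v & atom v p]].
suff truth psi j v : depth psi <= j -> j <= depth phi ->
    interp xi val psi (e j v) <-> forces v psi.
  move=> wN /(_ val) phiT; apply: wN.
  by apply/(truth phi (depth phi)); rewrite ?phiT.
elim: psi j v => [p||a IHa b IHb|a IHa b IHb] j v /=.
- move=> _ jk; split=> [[i [u [ik /e_inj ->]]]|vp] //.
  by exists j, v.
- by [].
- rewrite geq_max => /andP[aj bj] jk.
  by rewrite /setC /setU /= IHa // IHb.
case: j => // j; rewrite ltnS geq_max => /andP[aj bj] jk.
have jk' := ltnW jk; split=> [ab u u' uu' ua|ab x xa].
  (* The arrow to [u'] shows that the machine halts on the copy of [u]. *)
  have [||y [/he]] := ab (e j u); [exact/IHa|by exists (e j u'); apply/he => //; exists u, u'|].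
  move=> /(_ jk) [t [t' [/e_inj ut -> tt']]] /IHb yb.
  exists t'; split; last exact: yb.
  by rewrite (ut jk' jk').
(* Halting on [x] already reveals [x] as the copy of a world with an outgoing arrow. *)
case=> y /he - /(_ jk) [u [u' [xu _ uu']]]; rewrite xu in xa *.
have [t [ut tb]] := ab u u' uu' (proj1 (IHa _ _ aj jk') xa).
by exists (e j t); split; [apply/he => //; exists u, t|apply/IHb].
Qed.

End Enumeration.

Theorem theorem4 (U : Type) (code : U -> nat) (hcode : bijective code)
    (phi0 : formula) :
  (forall (K : kripke_model) (w : K), ~ forces w phi0 ->
     forall xi : U -> U -> set U, enumeration true code xi -> ~ valid xi phi0)
  /\
  (forall (K : kripke_model) (w : K), deterministic K -> ~ forces w phi0 ->
     forall xi : U -> U -> set U, enumeration false code xi -> ~ valid xi phi0).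
Proof.
split=> [K w wN xi xi_enum|K w det wN xi xi_enum].
  by apply: (refuted_not_valid hcode xi_enum _ wN); left.
by apply: (refuted_not_valid hcode xi_enum _ wN); right.
Qed.
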